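(* There exists an absolute constant $C>0$ such that the following holds. Let $0<\varepsilon<1/2$ and let $t,n$ be positive integers with $n>\varepsilon^{-Ct}$. Then every red/blue colouring of the edges of $K_n$ in which every vertex is incident to at least $\varepsilon n$ red edges and at least $\varepsilon n$ blue edges contains a $t$-locally-unavoidable pattern, i.e. there is a set $W$ of vertices such that the colouring restricted to the complete graph on $W$ satisfies one of the following: (i) $|W|=2t$ and for some colour $c$, $W=P\cup Q$ with $P,Q$ disjoint, $|P|=|Q|=t$, all edges between $P$ and $Q$ of colour $c$ and all edges inside $P$ and inside $Q$ of the other colour (so colour $c$ induces exactly a $K_{t,t}$); or (ii) $|W|=4t$ and the restricted colouring lies in $\mathcal{P}_t$ (with the colours possibly interchanged is not required; exactly as defined below).
   Context: For a positive integer $m$, a 2-colouring of $K_{4m}$ is in $\mathcal{P}_m$ if its vertex set can be partitioned into four sets $V_1,V_2,V_3,V_4$, each of size $m$, such that: all edges with both endpoints in $V_1\cup V_2$ are red; all edges with both endpoints in $V_3\cup V_4$ are blue; all edges between $V_1$ and $V_3$ are red; all edges between $V_2$ and $V_4$ are red; and all remaining edges (those between $V_1$ and $V_4$ and those between $V_2$ and $V_3$) are blue. *)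

(* Defs.v *)
From mathcomp Require Import all_boot.

Set Implicit Arguments.
Unset Strict Implicit.
Unset Printing Implicit Defensive.

(* A red/blue colouring of the edges of the complete graph on T is a symmetric
   function T -> T -> bool; the (meaningless) diagonal values are never used. *)
Definition red : bool := true.
Definition blue : bool := false.

Section Colouring.

Variables (T : finType) (f : T -> T -> bool).

Definition cdeg (c : bool) (v : T) : nat := #|[set w | (w != v) && (f v w == c)]|.

Definition inside (c : bool) (A : {set T}) : Prop :=
  forall x y, x \in A -> y \in A -> x != y -> f x y = c.

Definition between (c : bool) (A B : {set T}) : Prop :=
  forall x y, x \in A -> y \in B -> x != y -> f x y = c.

Definition induces_Ktt (t : nat) (W : {set T}) : Prop :=
  #|W| = 2 * t /\
  exists (c : bool) (P Q : {set T}),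
    [/\ W = P :|: Q, [disjoint P & Q], #|P| = t & #|Q| = t] /\
    [/\ between c P Q, inside (~~ c) P & inside (~~ c) Q].

Definition induces_P (m : nat) (W : {set T}) : Prop :=
  #|W| = 4 * m /\
  exists V1 V2 V3 V4 : {set T},
    [/\ W = V1 :|: V2 :|: V3 :|: V4,
        [/\ [disjoint V1 & V2], [disjoint V1 & V3] & [disjoint V1 & V4]],
        [/\ [disjoint V2 & V3], [disjoint V2 & V4] & [disjoint V3 & V4]]
      & [/\ #|V1| = m, #|V2| = m, #|V3| = m & #|V4| = m]] /\
    [/\ inside red (V1 :|: V2) /\ inside blue (V3 :|: V4),
        between red V1 V3, between red V2 V4,
        between blue V1 V4 & between blue V2 V3].

Definition has_locally_unavoidable (t : nat) : Prop :=
  exists W : {set T}, induces_Ktt t W \/ induces_P t W.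

End Colouring.

(* Main.v *)
Require Import Defs.
From Stdlib Require Import Classical.
From mathcomp Require Import all_boot zify.

Set Implicit Arguments.
Unset Strict Implicit.
Unset Printing Implicit Defensive.

(* Call a set c-free if it contains no t-clique of colour c, and suppose that
   pattern (i) does not occur. By dependent random choice every large set
   contains a large red-free or blue-free subset, so up to a negligible
   remainder the vertex set splits into a union A of blue-free parts and a
   union B of red-free parts of equal size. Blue is sparse between any two
   large blue-free sets, since otherwise dependent random choice and Ramsey
   would give pattern (i); hence A is almost red, B is almost blue, and the
   degree condition forces every typical vertex of A to have many blue
   neighbours in B and every typical vertex of B many red neighbours in A.
   Comparing the red degrees of two vertices of A then yields a positive density
   of four-cycles a b a' b' with a, a' in A and b, b' in B whose edges alternate
   in colour. Dependent random choice for pairs (a, a') against pairs (b, b')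
   blows such a four-cycle up, and Ramsey inside the parts turns the four
   classes into the cliques of the pattern P_t.

   The quantitative bookkeeping is done in nat: K plays the role of 1/eps, Q is a
   power of K bounding all inverse densities, and M, which is roughly the eighth
   root of the number of vertices, is the factor lost at each use of dependent
   random choice. *)

(** * Counting and selection in finite sets, and dependent random choice *)

Lemma double_count (S T : finType) (A : {set S}) (B : {set T}) (R : S -> T -> bool) :
  \sum_(b in B) #|[set a in A | R a b]| = \sum_(a in A) #|[set b in B | R a b]|.
Proof.
under eq_bigr => b _ do rewrite -sum1dep_card.
under [RHS]eq_bigr => a _ do rewrite -sum1dep_card.
rewrite (exchange_big_dep (fun a => a \in A)) => [|b a _ /andP[]//].
by apply: eq_bigr => a aA; apply: eq_bigl => b; rewrite aA.
Qed.

Lemma subset_of_card (T : finType) (A : {set T}) m : m <= #|A| ->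
  exists2 S : {set T}, S \subset A & #|S| = m.
Proof.
move=> le_m; exists [set x in take m (enum A)].
  by apply/subsetP=> x; rewrite inE => /mem_take; rewrite mem_enum.
rewrite cardsE; have /card_uniqP -> : uniq (take m (enum A)).
  by rewrite take_uniq ?enum_uniq.
by rewrite size_takel // -cardE.
Qed.

Lemma card_cond_sum (T : finType) (S : {set T}) (p : pred T) :
  #|[set w in S | p w]| = \sum_(w in S) p w.
Proof.
by rewrite -sum1dep_card big_mkcondr; apply: eq_bigr => w _; case: (p w).
Qed.

Lemma card_cond_cover (T : finType) (P : {set {set T}}) (p : pred T) : trivIset P ->
  #|[set w in cover P | p w]| = \sum_(S in P) #|[set w in S | p w]|.
Proof.
move=> tiP; rewrite card_cond_sum big_trivIset //.
by apply: eq_bigr => S _; rewrite card_cond_sum.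
Qed.

Lemma card_le_fst (S1 S2 : finType) (W : {set S1 * S2}) (B : {set S2}) :
  {subset W <= [pred p | p.2 \in B]} -> #|W| <= #|fst @: W| * #|B|.
Proof.
move=> WB; rewrite -cardsX; apply/subset_leq_card/subsetP=> p pW.
by rewrite inE imset_f //; exact: WB.
Qed.

Lemma card_le_snd (S1 S2 : finType) (W : {set S1 * S2}) (A : {set S1}) :
  {subset W <= [pred p | p.1 \in A]} -> #|W| <= #|A| * #|snd @: W|.
Proof.
move=> WA; rewrite -cardsX; apply/subset_leq_card/subsetP=> p pW.
by rewrite inE imset_f // andbT; exact: WA.
Qed.

(** Lifts a clique found among the coordinates of pairs back to no more pairs than vertices, so that
    dependent random choice on pairs applies to it. *)
Lemma exists_transversal (S1 S2 : finType) (h : S1 -> S2) (W : {set S1}) (X : {set S2}) :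
  X \subset h @: W -> exists Z : {set S1},
    [/\ Z \subset W, #|Z| <= #|X| & forall x, x \in X -> exists2 p, p \in Z & h p = x].
Proof.
move=> XW; have [->|[x0 x0X]] := set_0Vmem X.
  by exists set0; rewrite sub0set cards0; split=> // x; rewrite inE.
have /imsetP[p0 p0W _] := subsetP XW _ x0X.
pose g x := odflt p0 [pick p in W | h p == x].
have gP x : g x \in W by rewrite /g; case: pickP => [p /andP[]|].
exists (g @: X); split; last 1 first.
- move=> x xX; exists (g x); first exact: imset_f.
  rewrite /g; case: pickP => [p /andP[_ /eqP]//|nop].
  have /imsetP[p pW xE] := subsetP XW _ xX.
  by have := nop p; rewrite pW xE eqxx.
- by apply/subsetP=> _ /imsetP[x _ ->].
exact: leq_imset_card.
Qed.

Lemma exists_top (T : finType) (F : T -> nat) (A : {set T}) l : l <= #|A| ->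
  exists L : {set T}, [/\ L \subset A, #|L| = l &
    forall x y, x \in L -> y \in A :\: L -> F y <= F x].
Proof.
elim: l => [|l IHl] leA.
  by exists set0; rewrite sub0set cards0; split=> // x y; rewrite inE.
have [L [LA cL topL]] := IHl (ltnW leA).
have : 0 < #|A :\: L| by rewrite cardsD (setIidPr LA) cL subn_gt0.
move=> /card_gt0P[v0 v0D]; case: (@arg_maxnP _ v0 (fun v => v \in A :\: L) F v0D).
move=> v vD maxv; have /setDP[vA vL] := vD.
exists (v |: L); split; first by rewrite subUset sub1set vA.
  by rewrite cardsU1 vL cL.
move=> x y; rewrite !inE negb_or => /predU1P[->|xL] /andP[/andP[_ yL] yA].
  by apply: maxv; rewrite inE yL.
by apply: topL => //; rewrite inE yL.
Qed.

(* A sample of r = 2Hs random elements of B has common neighbourhood U of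
   expected size at least |A| / q^r, while the expected number of s-tuples in U
   with fewer than |B| / M common neighbours is at most |A|^s / M^r. *)
Lemma dependent_random_choice (S T : finType) (E : S -> T -> bool)
    (A : {set S}) (B : {set T}) (q M s H : nat) :
  1 < M -> 1 < H * s -> 2 * q ^ (2 * (H * s)) <= M -> #|A| <= M ^ H ->
  (forall a, a \in A -> #|B| <= q * #|[set b in B | E a b]|) ->
  exists U : {set S}, [/\ U \subset A, #|A| <= M * #|U| &
    forall X : {set S}, X \subset U -> #|X| <= s ->
      #|B| <= M * #|[set b in B | [forall a in X, E a b]]|].
Proof.
move=> M_gt1 Hs_gt1 leM leA degA; pose r := 2 * (H * s).
have r_gt0 : 0 < r by rewrite /r; lia.
have M_gt0 := ltnW M_gt1.
have [A0|A_gt0] := posnP #|A|.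
  exists A; split=> [//||X]; rewrite ?A0 // (cards0_eq A0) subset0 => /eqP -> _.
  rewrite (_ : [set _ in B | _] = B) ?leq_pmull //.
  by apply/setP=> b; rewrite inE andbC; case: forall_inP => // -[] a; rewrite inE.
have [B0|B_gt0] := posnP #|B|.
  by exists A; split=> [//||X _ _]; rewrite ?B0 // leq_pmull.
pose common n (x : {ffun 'I_n -> S}) := [set b in B | [forall i, E (x i) b]].
pose F := [set w : {ffun 'I_r -> T} | w \in ffun_on (mem B)].
pose U (w : {ffun 'I_r -> T}) := [set a in A | [forall i, E a (w i)]].
pose bad := [set x : {ffun 'I_s -> S} |
  (x \in ffun_on (mem A)) && (M * #|common s x| < #|B|)].
pose badU w := [set x in bad | [forall j, x j \in U w]].
have cardF : #|F| = #|B| ^ r by rewrite cardsE card_ffun_on card_ord.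
have [/exists_inP[w wF /andP[/eqP bad0 leU]]|/exists_inPn noU] :=
    boolP [exists w in F, (#|badU w| == 0) && (#|A| <= M * #|U w|)].
  exists (U w); split=> [|//|X XU leX].
    by apply/subsetP=> a; rewrite inE => /andP[].
  have [X0|[a0 a0X]] := set_0Vmem X.
    rewrite (_ : [set _ in B | _] = B) ?leq_pmull //.
    apply/setP=> b; rewrite X0 inE andbC; case: forall_inP => // -[] a.
    by rewrite inE.
  (* A set [X] with fewer than [s] elements is padded to an [s]-tuple by repeating [a0], itself in
     [X], so the common neighbourhood is unchanged. *)
  pose x : {ffun 'I_s -> S} := [ffun j : 'I_s => nth a0 (enum X) j].
  have xX j : x j \in X.
    rewrite ffunE; have [lt_j|ge_j] := ltnP j (size (enum X)).
      by rewrite -mem_enum mem_nth.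
    by rewrite nth_default.
  have comE : [set b in B | [forall a in X, E a b]] = common s x.
    apply/setP=> b; rewrite !inE; congr (_ && _).
    apply/forall_inP/forallP=> [Eb j|Eb a aX]; first exact: Eb.
    have ltj : index a (enum X) < s.
      by apply: leq_trans leX; rewrite cardE index_mem mem_enum.
    by have := Eb (Ordinal ltj); rewrite ffunE /= nth_index ?mem_enum.
  rewrite comE leqNgt; apply/negP=> x_bad.
  have /setP/(_ x) := cards0_eq bad0.
  rewrite !inE x_bad andbT => /negP; apply; apply/andP; split.
    apply/ffun_onP=> j; have /(subsetP XU) := xX j.
    by rewrite inE => /andP[].
  by apply/forallP=> j; exact: (subsetP XU) (xX j).
have sumU : #|A| * #|B| ^ r <= q ^ r * \sum_(w in F) #|U w|.
  rewrite double_count big_distrr /= -sum_nat_const leq_sum // => a aA.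
  rewrite (_ : [set w in F | _] =
    [set w | w \in ffun_on (mem [set b in B | E a b])]).
    rewrite cardsE card_ffun_on card_ord -expnMn leq_exp2r //; exact: degA.
  apply/setP=> w; rewrite !inE; apply/andP/ffun_onP=> [[/ffun_onP wB /forallP Ew] i|wB].
    by rewrite !inE wB Ew.
  split; first by apply/ffun_onP=> i; have := wB i; rewrite !inE => /andP[].
  by apply/forallP=> i; have := wB i; rewrite !inE => /andP[].
have sum_bad : M ^ r * \sum_(w in F) #|badU w| <= M ^ (H * s) * #|B| ^ r.
  rewrite double_count big_distrr /=.
  apply: (@leq_trans (\sum_(x in bad) #|B| ^ r)).
    apply: leq_sum => x; rewrite inE => /andP[xA /ltnW x_bad].
    rewrite (_ : [set w in F | _] =
      [set w | w \in ffun_on (mem (common s x))]).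
      by rewrite cardsE card_ffun_on card_ord -expnMn leq_exp2r.
    apply/setP=> w; rewrite !inE; apply/andP/ffun_onP=> [[/ffun_onP wB /forallP Ew] i|wB].
      rewrite !inE wB; apply/forallP=> j.
      by have := Ew j; rewrite inE => /andP[_ /forallP].
    split; first by apply/ffun_onP=> i; have := wB i; rewrite !inE => /andP[].
    apply/forallP=> j; rewrite inE (ffun_onP xA) /=; apply/forallP=> i.
    by have := wB i; rewrite !inE => /andP[_ /forallP].
  rewrite sum_nat_const leq_mul2r; apply/orP; right.
  have leAs : #|A| ^ s <= M ^ (H * s).
    by rewrite expnM; case: (s) => // s'; rewrite leq_exp2r.
  apply: leq_trans leAs.
  have -> : #|A| ^ s = #|[set x : {ffun 'I_s -> S} | x \in ffun_on (mem A)]|.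
    by rewrite cardsE card_ffun_on card_ord.
  by apply/subset_leq_card/subsetP=> x; rewrite !inE => /andP[].
(* Averaging in additive form: a failing sample either contains a bad tuple, and the first term pays
   for all of [U w], or has [U w] smaller than [#|A| / M], and [2 * q ^ r <= M]. *)
have le_term w : w \in F ->
    2 * q ^ r * #|U w| <= 2 * q ^ r * #|A| * #|badU w| + #|A|.
  move=> wF; have := noU w wF; rewrite negb_and -lt0n -ltnNge => /orP[bad_gt0|ltU].
    apply: leq_trans (leq_addr _ _); rewrite -[leqRHS]mulnA leq_mul2l.
    apply/orP; right; rewrite (leq_trans _ (leq_pmulr _ bad_gt0)) //.
    by apply/subset_leq_card/subsetP=> a; rewrite inE => /andP[].
  apply: leq_trans (leq_addl _ _); apply: leq_trans (ltnW ltU).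
  by rewrite leq_mul2r leM orbT.
have := leq_sum (index_enum _) le_term.
rewrite -big_distrr big_split -big_distrr sum_nat_const cardF /=.
set sU := \sum_(w in F) #|U w| in sumU *.
set sb := \sum_(w in F) #|badU w| in sum_bad *.
move=> le_sum.
have le1 : #|A| * #|B| ^ r <= #|A| * (2 * q ^ r * sb).
  rewrite -(leq_add2r (#|A| * #|B| ^ r)) [X in _ <= _ + X]mulnC.
  apply: leq_trans (_ : 2 * q ^ r * sU <= _); first by lia.
  by apply: leq_trans le_sum _; rewrite leq_add2r mulnA [#|A| * _]mulnC.
rewrite leq_pmul2l // in le1.
(* Cancelling [#|B| ^ r] leaves [M ^ r <= M ^ (1 + H * s)], which [r = 2 * (H * s)] and [1 < H * s]
   exclude. *)
have le2 : M ^ r * #|B| ^ r <= M * M ^ (H * s) * #|B| ^ r.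
  apply: leq_trans (_ : M ^ r * (M * sb) <= _).
    by rewrite leq_mul2l (leq_trans le1) ?orbT // leq_mul2r leM orbT.
  by rewrite mulnCA -mulnA leq_mul2l sum_bad orbT.
by move: le2; rewrite leq_pmul2r ?expn_gt0 ?B_gt0 // -expnS leq_exp2l //; rewrite /r; lia.
Qed.

(** * Ramsey's theorem for two colours *)

Section Colouring.

Variables (T : finType) (f : T -> T -> bool).
Hypothesis fsym : symmetric f.

Lemma inside_setU1 c v (A : {set T}) :
  inside f c A -> (forall w, w \in A -> f v w = c) -> inside f c (v |: A).
Proof.
move=> cA vA x y; rewrite !inE => /predU1P[->|xA] /predU1P[->|yA] neq.
- by rewrite eqxx in neq.
- exact: vA.
- by rewrite fsym vA.
exact: cA.
Qed.

Lemma inside_setU c (A B : {set T}) :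
  inside f c A -> inside f c B -> between f c A B -> inside f c (A :|: B).
Proof.
move=> cA cB cAB x y; rewrite !inE => /orP[xA|xB] /orP[yA|yB] neq.
- exact: cA.
- exact: cAB.
- by rewrite fsym cAB // eq_sym.
exact: cB.
Qed.

(** Induction on [s + u]: one of the two colour neighbourhoods of a vertex [v] is large enough for a
    smaller instance, and [v] extends a clique of the matching colour. *)
Lemma Ramsey_bound s u (A : {set T}) : 2 ^ (s + u) <= #|A| ->
  (exists X : {set T}, [/\ X \subset A, #|X| = s & inside f red X]) \/
  (exists X : {set T}, [/\ X \subset A, #|X| = u & inside f blue X]).
Proof.
have inside0 c : inside f c set0 by move=> x y; rewrite inE.
have [m] := ubnP (s + u); elim: m s u A => // m IHm [|s] u A le_m leA.
  by left; exists set0; rewrite sub0set cards0.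
case: u => [|u] in le_m leA *; first by right; exists set0; rewrite sub0set cards0.
have /card_gt0P[v vA] : 0 < #|A| by apply: leq_trans leA; rewrite expn_gt0.
pose N c := [set w in A :\ v | f v w == c].
have cardN : #|A| = (#|N red| + #|N blue|).+1.
  rewrite (cardsD1 v) vA add1n; congr _.+1.
  rewrite -(cardsID [set w | f v w]); congr (_ + _).
    by apply: eq_card => w; rewrite !inE eqb_id.
  by apply: eq_card => w; rewrite !inE eqbF_neg andbC.
have subN c : N c \subset A.
  by apply/subsetP=> w; rewrite !inE => /andP[/andP[_ ->]].
have extend c (X : {set T}) : X \subset N c -> inside f c X ->
    [/\ v |: X \subset A, #|v |: X| = #|X|.+1 & inside f c (v |: X)].
  move=> XN cX; split.
  - by rewrite subUset sub1set vA (subset_trans XN).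
  - rewrite cardsU1 (_ : v \in X = false) //.
    by apply/negP=> /(subsetP XN); rewrite !inE eqxx.
  by apply: inside_setU1 => // w /(subsetP XN); rewrite inE => /andP[_ /eqP].
have [leN|ltN] := leqP (2 ^ (s + u.+1)) #|N red|.
  have [|[X [XN cX iX]]|[X [XN cX iX]]] := IHm _ _ _ _ leN; first by lia.
    by left; exists (v |: X); have [? -> ?] := extend _ _ XN iX; rewrite cX.
  by right; exists X; rewrite (subset_trans XN).
have leN : 2 ^ (s.+1 + u) <= #|N blue|.
  move: leA; rewrite cardN addSn expnS.
  by move: ltN; rewrite addnS addSn; lia.
have [|[X [XN cX iX]]|[X [XN cX iX]]] := IHm _ _ _ _ leN; first by lia.
  by left; exists X; rewrite (subset_trans XN).
by right; exists (v |: X); have [? -> ?] := extend _ _ XN iX; rewrite cX.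
Qed.

End Colouring.

(** * Colourings without pattern (i): parameters and clique-free sets *)

Section LocallyUnavoidable.

Variables (T : finType) (f : T -> T -> bool) (t M K Q : nat).

Definition cnbr c v (S : {set T}) := [set w in S | (w != v) && (f v w == c)].

(** Boolean counterpart of [inside], so that clique-freeness can serve in set comprehensions and
    case splits. *)
Definition clique c (X : {set T}) :=
  [forall x in X, forall y in X, (x != y) ==> (f x y == c)].

Definition clique_free c (S : {set T}) :=
  [forall X : {set T}, (X \subset S) && (#|X| == t) ==> ~~ clique c X].

Lemma cliqueP c (X : {set T}) : reflect (inside f c X) (clique c X).
Proof.
apply: (iffP forall_inP) => [cX x y xX yX neq|cX x xX].
  by have /forall_inP/(_ y yX)/implyP/(_ neq)/eqP := cX x xX.
by apply/forall_inP=> y yX; apply/implyP=> neq; apply/eqP/cX.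
Qed.

Lemma clique_freePn c (S : {set T}) :
  reflect (exists X : {set T}, [/\ X \subset S, #|X| = t & inside f c X])
          (~~ clique_free c S).
Proof.
apply: (iffP forallPn) => [[X]|[X [XS cX iX]]].
  rewrite negb_imply negbK => /andP[/andP[XS /eqP cX] /cliqueP iX].
  by exists X.
by exists X; rewrite negb_imply negbK XS cX eqxx; apply/cliqueP.
Qed.

Lemma clique_freeP c (S X : {set T}) :
  clique_free c S -> X \subset S -> #|X| = t -> ~ inside f c X.
Proof.
move=> freeS XS cX iX; suff : ~~ clique_free c S by rewrite freeS.
by apply/clique_freePn; exists X.
Qed.

Lemma clique_freeS c (S S' : {set T}) :
  S \subset S' -> clique_free c S' -> clique_free c S.
Proof.
move=> SS'; apply: contraTT => /clique_freePn[X [XS cX iX]].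
by apply/clique_freePn; exists X; rewrite (subset_trans XS).
Qed.

Hypothesis fsym : symmetric f.
Hypothesis t_gt0 : 0 < t.
Hypothesis K_gt0 : 0 < K.
Hypothesis leKQ : 256 * K ^ 4 <= Q.
(** The exponent is that of dependent random choice with [H = 32] and [s = 2 * t]: there are at most
    [M ^ 32] pairs of vertices, and up to [2 * t] pairs are used at once. *)
Hypothesis leQM : 2 * Q ^ (2 * (32 * (2 * t))) <= M.
Hypothesis leMn : M ^ 8 <= #|T|.
Hypothesis lenM : #|T| <= M ^ 16.
Hypothesis noKtt : ~ exists W, induces_Ktt f t W.

Lemma sample_gt1 : 1 < 32 * (2 * t).
Proof. by lia. Qed.

Lemma Q_ge256 : 256 <= Q.
Proof. by apply: leq_trans leKQ; rewrite leq_pmulr // expn_gt0 K_gt0. Qed.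

Lemma Q4_le_M : 2 * Q ^ 4 <= M.
Proof.
apply: leq_trans leQM; rewrite leq_mul2l leq_pexp2l //; last by lia.
by apply: leq_trans Q_ge256.
Qed.

Lemma Q_le_M : 512 * Q <= M.
Proof.
have leQ := Q_ge256; apply: leq_trans Q4_le_M; apply: leq_trans (_ : 2 * Q ^ 2 <= _).
  by rewrite -mulnn mulnA leq_mul2r; apply/orP; right; lia.
by rewrite leq_mul2l leq_pexp2l //; lia.
Qed.

Lemma M_gt1 : 1 < M.
Proof. by have := Q_le_M; have := Q_ge256; lia. Qed.

Lemma T_gt0 : 0 < #|T|.
Proof. by apply: leq_trans leMn; rewrite expn_gt0 ltnW // M_gt1. Qed.

Lemma Ramsey_le_M : 2 ^ (t + t) <= M.
Proof.
have Q_gt0 : 0 < Q by apply: leq_trans Q_ge256.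
apply: leq_trans leQM; apply: leq_trans (leq_pmull _ _) => //.
apply: leq_trans (_ : Q ^ (t + t) <= _); last by rewrite leq_pexp2l //; lia.
by rewrite leq_exp2r; [apply: leq_trans Q_ge256 | lia].
Qed.

Lemma monochromatic_biclique c (X Y : {set T}) :
  #|X| = t -> #|Y| = t -> [disjoint X & Y] ->
  inside f (~~ c) X -> inside f (~~ c) Y -> between f c X Y -> False.
Proof.
move=> cX cY dXY iX iY bXY; apply: noKtt; exists (X :|: Y); split.
  by rewrite cardsU (disjoint_setI0 dXY) cards0 cX cY; lia.
by exists c, X, Y.
Qed.

Lemma clique_free_Ramsey c (S : {set T}) : clique_free c S -> M <= #|S| ->
  exists X : {set T}, [/\ X \subset S, #|X| = t & inside f (~~ c) X].
Proof.
move=> freeS leS; have := Ramsey_bound fsym (leq_trans Ramsey_le_M leS).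
move=> [[X [XS cX iX]]|[X [XS cX iX]]]; have := @clique_freeP c S X freeS XS cX;
  by case: c {freeS} => // _; exists X.
Qed.

(** Dependent random choice in one colour. Since [E] excludes [w = v], a set is automatically
    disjoint from its common neighbourhood. *)
Lemma large_common_nbr c (S1 S2 : {set T}) :
  (forall a, a \in S1 -> #|S2| <= Q * #|cnbr c a S2|) ->
  exists U : {set T}, [/\ U \subset S1, #|S1| <= M * #|U| &
    forall X : {set T}, X \subset U -> #|X| = t ->
    exists N : {set T}, [/\ N \subset S2, #|S2| <= M * #|N|,
                            [disjoint X & N] & between f c X N]].
Proof.
move=> deg; pose E v w := (w != v) && (f v w == c).
have leS1 : #|S1| <= M ^ 32.
  rewrite (leq_trans (max_card _)) // (leq_trans lenM) //.
  by rewrite leq_pexp2l // ltnW // M_gt1.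
have [U [US leU comU]] :=
  dependent_random_choice M_gt1 sample_gt1 leQM leS1 deg.
exists U; split=> // X XU cX; have leX : #|X| <= 2 * t by lia.
exists [set b in S2 | [forall a in X, E a b]]; split.
- by apply/subsetP=> b; rewrite inE => /andP[].
- exact: comU.
- rewrite disjoint_subset; apply/subsetP=> x xX; rewrite !inE negb_and.
  by apply/orP; right; apply/forall_inPn; exists x; rewrite // /E eqxx.
by move=> x y xX; rewrite inE => /andP[_ /forall_inP/(_ x xX)/andP[_ /eqP]].
Qed.

Lemma cnbr_compl c v (S : {set T}) :
  #|S| <= (#|cnbr c v S| + #|cnbr (~~ c) v S|).+1.
Proof.
apply: leq_trans (_ : #|S :\ v|.+1 <= _).
  by rewrite (cardsD1 v S); case: (v \in S).
rewrite ltnS -(cardsID [set w | f v w == c] (S :\ v)) leq_add //;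
  apply/subset_leq_card/subsetP=> w; rewrite !inE.
  by move=> /andP[/andP[-> ->]].
move=> /and3P[neq -> ->] /=.
by move: neq; case: (f v w); case: (c).
Qed.

(* In the majority colour c, take U whose t-subsets have large common
   c-neighbourhoods. Either U has no clique of colour ~~ c, or the common
   c-neighbourhood of such a clique has none. *)
Lemma exists_clique_free m (S0 : {set T}) : 0 < m -> 2 * M * m <= #|S0| ->
  exists c (S : {set T}), [/\ S \subset S0, #|S| = m & clique_free c S].
Proof.
move=> m_gt0 leS0.
have S0_ge : 4 <= #|S0| by have := Q_le_M; have := Q_ge256; nia.
(* The factor 4 instead of 2 absorbs the vertex itself, which lies in neither of its
   neighbourhoods. *)
pose maj c := [set a in S0 | #|S0| <= 4 * #|cnbr c a S0|].
have [c lec] : exists c, #|S0| <= 2 * #|maj c|.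
  suff : #|S0| <= #|maj red| + #|maj blue|.
    move=> leadd; have [le_rb|/ltnW le_br] := leqP #|maj red| #|maj blue|.
      by exists blue; lia.
    by exists red; lia.
  have sub : S0 \subset maj red :|: maj blue.
    apply/subsetP=> a aS; rewrite !inE aS /=.
    by have := cnbr_compl red a S0; case: leqP => //=; rewrite /red /blue /=; lia.
  exact: leq_trans (subset_leq_card sub) (leq_card_setU _ _).1.
have [|U [US leU comU]] := @large_common_nbr c (maj c) S0.
  move=> a; rewrite inE => /andP[_ le4]; apply: leq_trans le4 _.
  by rewrite leq_mul2r (leq_trans _ Q_ge256) ?orbT.
suff [S [SS leS freeS]] : exists S : {set T},
    [/\ S \subset S0, m <= #|S| & clique_free (~~ c) S].
  have [S' SS' cS'] := subset_of_card leS.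
  by exists (~~ c), S'; rewrite (subset_trans SS') // cS' (clique_freeS SS').
have M_gt0 := ltnW M_gt1.
have [freeU|/clique_freePn[X [XU cX iX]]] := boolP (clique_free (~~ c) U).
  exists U; split=> //.
    by apply: subset_trans US _; apply/subsetP=> a; rewrite inE => /andP[].
  by rewrite -(leq_pmul2l M_gt0); lia.
have [N [NS leN dXN bXN]] := comU X XU cX.
exists N; split=> //.
  by rewrite -(leq_pmul2l M_gt0); lia.
apply/negPn/negP=> /clique_freePn[Y [YN cY iY]].
apply: (@monochromatic_biclique c X Y) => //.
  by apply: disjointWr YN dXN.
by move=> x y xX /(subsetP YN); exact: bXN.
Qed.

(** Otherwise [U] and a common neighbourhood [N] have at least [M] elements, enough for Ramsey.
    Being free of [c], they yield cliques of colour [~~ c] joined completely in [c], which is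
    pattern (i). *)
Lemma clique_free_sparse c (S1 S2 : {set T}) :
  clique_free c S1 -> clique_free c S2 -> M ^ 2 <= #|S1| -> M ^ 2 <= #|S2| ->
  ~ forall a, a \in S1 -> #|S2| <= Q * #|cnbr c a S2|.
Proof.
move=> free1 free2 le1 le2 /large_common_nbr[U [US leU comU]].
have M_gt0 := ltnW M_gt1.
have [|X [XU cX iX]] := clique_free_Ramsey (clique_freeS US free1).
  by rewrite -(leq_pmul2l M_gt0); lia.
have [N [NS leN dXN bXN]] := comU X XU cX.
have [|Y [YN cY iY]] := clique_free_Ramsey (clique_freeS NS free2).
  by rewrite -(leq_pmul2l M_gt0); lia.
apply: (@monochromatic_biclique c X Y) => //.
  by apply: disjointWr YN dXN.
by move=> x y xX /(subsetP YN); exact: bXN.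
Qed.

Lemma clique_free_dense_few c (S1 S2 : {set T}) :
  clique_free c S1 -> clique_free c S2 -> M ^ 2 <= #|S2| ->
  #|[set a in S1 | #|S2| <= Q * #|cnbr c a S2|]| < M ^ 2.
Proof.
move=> free1 free2 le2; rewrite ltnNge; apply/negP=> le1.
apply: (@clique_free_sparse c _ S2) le1 le2 _ => //.
  by apply: clique_freeS free1; apply/subsetP=> a; rewrite inE => /andP[].
by move=> a; rewrite inE => /andP[].
Qed.

(** As [c] is sparse between [S1] and [S2], many vertices of [S1] are dense to [S2] in [~~ c]. The
    same argument run in [~~ c] now joins the two cliques by their own colour. *)
Lemma clique_free_join c (S1 S2 : {set T}) :
  clique_free c S1 -> clique_free c S2 ->
  2 * M ^ 2 <= #|S1| -> M ^ 2 <= #|S2| ->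
  exists X1 X2 : {set T}, [/\ X1 \subset S1, X2 \subset S2,
    #|X1| = t, #|X2| = t & [disjoint X1 & X2] /\ inside f (~~ c) (X1 :|: X2)].
Proof.
move=> free1 free2 le1 le2; have M_gt0 := ltnW M_gt1.
have M2_gt4 : 4 < M ^ 2 by have := Q_le_M; have := Q_ge256; rewrite !expnS expn0; nia.
pose S1' := [set a in S1 | #|S2| <= Q * #|cnbr (~~ c) a S2|].
have S1'S : S1' \subset S1 by apply/subsetP=> a; rewrite inE => /andP[].
have leS1' : M ^ 2 <= #|S1'|.
  have few := clique_free_dense_few free1 free2 le2.
  suff : #|S1| <= #|[set a in S1 | #|S2| <= Q * #|cnbr c a S2|]| + #|S1'|.
    by move: few; lia.
  set S1c := [set _ in _ | _].
  have sub : S1 \subset S1c :|: S1'.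
    apply/subsetP=> a aS; rewrite !inE aS /=.
    have := cnbr_compl c a S2; have := Q_ge256.
    by case: leqP => //=; nia.
  exact: leq_trans (subset_leq_card sub) (leq_card_setU _ _).1.
have [|U [US leU comU]] := @large_common_nbr (~~ c) S1' S2.
  by move=> a; rewrite inE => /andP[].
have US1 := subset_trans US S1'S.
have [|X [XU cX iX]] := clique_free_Ramsey (clique_freeS US1 free1).
  by rewrite -(leq_pmul2l M_gt0); lia.
have [N [NS leN dXN bXN]] := comU X XU cX.
have [|Y [YN cY iY]] := clique_free_Ramsey (clique_freeS NS free2).
  by rewrite -(leq_pmul2l M_gt0); lia.
exists X, Y; split=> //; rewrite ?(subset_trans XU) ?(subset_trans YN) //.
split; first by apply: disjointWr YN dXN.
by apply: inside_setU => // x y xX /(subsetP YN); exact: bXN.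
Qed.

(** * Families of disjoint clique-free sets *)

Definition free_family c m (P : {set {set T}}) :=
  trivIset P /\ forall S, S \in P -> #|S| = m /\ clique_free c S.

(** A maximal family of disjoint clique-free [m]-sets works: [exists_clique_free] would find one
    more in a larger remainder. *)
Lemma free_partition m : 0 < m ->
  exists PA PB : {set {set T}},
    [/\ free_family blue m PA, free_family red m PB,
        [disjoint cover PA & cover PB] &
        #|~: (cover PA :|: cover PB)| < 2 * M * m].
Proof.
move=> m_gt0.
pose good (S : {set T}) :=
  (#|S| == m) && (clique_free blue S || clique_free red S).
pose fam (P : {set {set T}}) := trivIset P && [forall S in P, good S].
have [|P maxP] := @ex_maxset _ fam.
  exists set0; rewrite /fam; apply/andP; split.
    by apply/trivIsetP=> S S'; rewrite inE.
  by apply/forall_inP=> S; rewrite inE.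
have /maxsetP[/andP[tiP /forall_inP goodP] _] := maxP.
(* A set free of both colours goes to [PA] only, which keeps the two covers disjoint. *)
pose PA := [set S in P | clique_free blue S]; pose PB := P :\: PA.
have PAP : PA \subset P by apply/subsetP=> S; rewrite inE => /andP[].
have PBP : PB \subset P by apply: subsetDl.
have coverE : cover PA :|: cover PB = cover P.
  apply/setP=> x; apply/setUP/bigcupP=> [[/bigcupP[S SP xS]|/bigcupP[S SP xS]]|[S SP xS]].
  - by exists S; rewrite // (subsetP PAP).
  - by exists S; rewrite // (subsetP PBP).
  by have [SA|SA] := boolP (S \in PA); [left|right];
    apply/bigcupP; exists S; rewrite // inE SA.
exists PA, PB; split.
- split; first exact: trivIsetS tiP.
  by move=> S; rewrite inE => /andP[/goodP/andP[/eqP-> _] ->].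
- split; first exact: trivIsetS tiP.
  move=> S; rewrite !inE => /andP[nA SP].
  have /andP[/eqP -> /orP[freeS|//]] := goodP S SP.
  by rewrite SP freeS in nA.
- rewrite -setI_eq0; apply/eqP/setP=> x; rewrite !inE; apply/andP.
  move=> [/bigcupP[S SA xS] /bigcupP[S' SB xS']].
  have neq : S != S' by apply: contraTneq SB => <-; rewrite inE SA.
  have := trivIsetP tiP S S' (subsetP PAP _ SA) (subsetP PBP _ SB) neq.
  by move/disjoint_setI0/setP/(_ x); rewrite !inE xS xS'.
rewrite coverE ltnNge; apply/negP=> /(exists_clique_free m_gt0)[c [S [Sout cS freeS]]].
have goodS : good S by rewrite /good cS eqxx; case: c freeS => -> //; rewrite orbT.
have S_disj S' : S' \in P -> [disjoint S & S'].
  move=> S'P; rewrite disjoint_subset; apply/subsetP=> x /(subsetP Sout).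
  rewrite !inE; apply: contraNN => xS'; apply/bigcupP; exists S' => //.
have [|tiSP SnP] := trivIsetU1 S_disj tiP.
  by apply/negP=> /goodP; rewrite /good cards0 eq_sym eqn0Ngt m_gt0.
have PE : S |: P = P.
  apply: (maxsetsup maxP); last exact: subsetUr.
  rewrite /fam tiSP; apply/forall_inP=> S'; rewrite !inE.
  by move=> /predU1P[->|/goodP].
by rewrite -PE setU11 in SnP.
Qed.

Lemma card_free_family c m P : free_family c m P -> #|P| * m <= #|T|.
Proof.
move=> [tiP famP]; apply: leq_trans (max_card (cover P)).
rewrite -(eqP tiP) -sum_nat_const; apply: leq_sum => S SP.
by have [-> _] := famP S SP.
Qed.

(** For two parts, possibly equal, the fewer than [M ^ 2] vertices of high degree contribute at most
    [m ^ 2] because [Q * M ^ 2 <= m], and so do the remaining ones. *)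
Lemma free_family_sparse c m P : free_family c m P ->
  Q * M ^ 2 <= m ->
  Q * \sum_(a in cover P) #|cnbr c a (cover P)| <= 2 * #|T| ^ 2.
Proof.
move=> famP leMm; have [tiP freeP] := famP.
have lePm := card_free_family famP.
have Q_gt0 : 0 < Q by apply: leq_trans Q_ge256.
have pairS S S' : S \in P -> S' \in P ->
    Q * \sum_(a in S) #|cnbr c a S'| <= 2 * m ^ 2.
  move=> SP S'P; have [cS freeS] := freeP S SP; have [cS' freeS'] := freeP S' S'P.
  have le2 : M ^ 2 <= #|S'|.
    by rewrite cS' (leq_trans _ leMm) // leq_pmull.
  have := clique_free_dense_few freeS freeS' le2.
  set D := [set a in S | _] => ltD.
  have DS : D \subset S by apply/subsetP=> a; rewrite inE => /andP[].
  rewrite (big_setID D) (setIidPr DS) /= mulnDr mul2n -addnn leq_add //.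
    apply: leq_trans (_ : Q * (#|D| * m) <= _).
      rewrite leq_mul2l -sum_nat_const leq_sum ?orbT // => a _.
      by rewrite -cS'; apply/subset_leq_card/subsetP=> w; rewrite inE => /andP[].
    by rewrite mulnA -mulnn leq_mul2r (leq_trans _ leMm) ?orbT // leq_mul2l ltnW ?orbT.
  apply: leq_trans (_ : \sum_(a in S :\: D) m <= _).
    rewrite big_distrr leq_sum // => a; rewrite !inE -cS' => /andP[nD aS] /=.
    by rewrite aS -ltnNge in nD; exact: ltnW.
  rewrite sum_nat_const -mulnn leq_mul2r; apply/orP; right.
  by rewrite -cS; apply/subset_leq_card/subsetDl.
rewrite big_trivIset //= big_distrr /=.
have le_part S : S \in P ->
    Q * \sum_(a in S) #|cnbr c a (cover P)| <= #|P| * (2 * m ^ 2).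
  move=> SP; under eq_bigr => a _ do rewrite card_cond_cover //.
  rewrite exchange_big /= big_distrr /= -sum_nat_const leq_sum // => S' S'P.
  exact: pairS.
apply: leq_trans (leq_sum _ le_part) _; rewrite sum_nat_const.
have : (#|P| * m) ^ 2 <= #|T| ^ 2 by rewrite leq_exp2r.
by rewrite expnMn -!mulnn; lia.
Qed.

(** Averaging over the parts, at most [#|T| / m] in number. *)
Lemma free_family_meets_large c m P (U : {set T}) : free_family c m P ->
  U \subset cover P -> 0 < #|U| ->
  exists2 S, S \in P & #|U| * m <= #|T| * #|S :&: U|.
Proof.
move=> famP UP U_gt0; have [tiP freeP] := famP.
have [/exists_inP//|/exists_inPn small] :=
  boolP [exists S in P, #|U| * m <= #|T| * #|S :&: U|].
have UE : #|U| = \sum_(S in P) #|S :&: U|.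
  have <- : [set w in cover P | w \in U] = U.
    by apply/setP=> w; rewrite inE andbC; case: (boolP (w \in U)) => // /(subsetP UP).
  rewrite card_cond_cover //; apply: eq_bigr => S _.
  apply: eq_card => w; rewrite !inE; case: (boolP (w \in U)) => /=; rewrite ?andbF ?andbT //.
  by move/(subsetP UP)->; rewrite andbT.
have /card_gt0P[x /(subsetP UP)/bigcupP[S0 S0P _]] := U_gt0.
have : \sum_(S in P) #|T| * #|S :&: U| < \sum_(S in P) #|U| * m.
  rewrite [ltnLHS](bigD1 S0) // [ltnRHS](bigD1 S0) //= -addSn leq_add //.
    by rewrite ltnNge small.
  by apply: leq_sum => S /andP[SP _]; rewrite ltnW // ltnNge small.
rewrite -big_distrr -UE sum_nat_const /= ltnNge mulnCA [#|T| * _]mulnC.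
by rewrite leq_mul2l (card_free_family famP) orbT.
Qed.

(** Each [U] meets some part in at least [2 * M ^ 2] vertices, where [clique_free_join] applies. The
    two parts may coincide; disjointness comes from the join. *)
Lemma free_family_join c m P (U1 U2 : {set T}) : free_family c m P ->
  #|T| <= 2 * M ^ 2 * m ->
  U1 \subset cover P -> U2 \subset cover P ->
  #|T| <= M ^ 2 * #|U1| -> #|T| <= M ^ 2 * #|U2| ->
  exists X1 X2 : {set T}, [/\ X1 \subset U1, X2 \subset U2,
    #|X1| = t, #|X2| = t & [disjoint X1 & X2] /\ inside f (~~ c) (X1 :|: X2)].
Proof.
move=> famP leTm; have M_gt0 := ltnW M_gt1.
have piece (U : {set T}) : U \subset cover P -> #|T| <= M ^ 2 * #|U| ->
    exists S : {set T}, [/\ S \subset U, clique_free c S & 2 * M ^ 2 <= #|S|].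
  move=> UP leU.
  have [|S SP leS] := free_family_meets_large famP UP.
    by case: posnP leU => // ->; rewrite muln0 leqNgt T_gt0.
  exists (S :&: U); split; first exact: subsetIr.
    by have [_ freeP] := famP; apply: clique_freeS (freeP S SP).2; exact: subsetIl.
  rewrite -(leq_pmul2l T_gt0); apply: leq_trans leS.
  have leM6 : 4 * M ^ 4 <= #|U|.
    rewrite -(@leq_pmul2l (M ^ 2)) ?expn_gt0 ?M_gt0 //; apply: leq_trans leU.
    apply: leq_trans leMn; rewrite mulnCA -expnD.
    apply: leq_trans (_ : M ^ 2 * M ^ 6 <= _); last by rewrite -expnD.
    rewrite leq_mul2r -mulnn; apply/orP; right.
    by have := Q_le_M; have := Q_ge256; nia.
  apply: leq_trans (_ : 2 * M ^ 2 * m * (2 * M ^ 2) <= _); first by rewrite leq_mul2r leTm orbT.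
  apply: leq_trans (_ : 4 * M ^ 4 * m <= _); last by rewrite leq_mul2r leM6 orbT.
  by rewrite (expnD M 2 2); lia.
move=> U1P U2P leU1 leU2.
have [S1 [SU1 free1 le1]] := piece U1 U1P leU1.
have [S2 [SU2 free2 le2]] := piece U2 U2P leU2.
have [|X1 [X2 [XS1 XS2 cX1 cX2 dX]]] := clique_free_join free1 free2 le1; first by lia.
by exists X1, X2; rewrite (subset_trans XS1) // (subset_trans XS2).
Qed.

(** * Trimming, and degrees between the two sides *)

(** Markov's inequality; [256 * K ^ 2 <= Q] covers the loss of two factors [8 * K] and of the factor
    2. *)
Lemma trim_sparse c (A : {set T}) :
  Q * \sum_(a in A) #|cnbr c a A| <= 2 * #|T| ^ 2 ->
  exists A0 : {set T}, [/\ A0 \subset A, 8 * K * #|A :\: A0| <= #|T| &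
    forall a, a \in A0 -> 8 * K * #|cnbr c a A| <= #|T|].
Proof.
move=> sparse; exists [set a in A | 8 * K * #|cnbr c a A| <= #|T|]; split.
- by apply/subsetP=> a; rewrite inE => /andP[].
- set D := A :\: _; have DA : D \subset A by apply: subsetDl.
  have leD : #|D| * #|T| <= 8 * K * \sum_(a in A) #|cnbr c a A|.
    rewrite (big_setID D) (setIidPr DA) /= mulnDr -sum_nat_const.
    apply: leq_trans (leq_addr _ _); rewrite big_distrr leq_sum // => a.
    by rewrite !inE => /andP[nle aA]; rewrite aA -ltnNge in nle; exact: ltnW.
  have K2 : K * K * 256 <= Q.
    by apply: leq_trans leKQ; rewrite mulnC leq_mul2l mulnn leq_pexp2l.
  have Q_gt0 : 0 < Q by apply: leq_trans Q_ge256.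
  rewrite -(leq_pmul2r T_gt0) mulnn -(leq_pmul2l Q_gt0).
  move: leD sparse; set s := \sum_(a in A) _ => leD sparse.
  apply: leq_trans (_ : 64 * (K * K) * (Q * s) <= _).
    have -> : 64 * (K * K) * (Q * s) = Q * (8 * K * (8 * K * s)) by lia.
    by rewrite leq_mul2l -mulnA leq_mul2l leD !orbT.
  apply: leq_trans (_ : 64 * (K * K) * (2 * #|T| ^ 2) <= _).
    by rewrite leq_mul2l sparse orbT.
  by rewrite mulnA leq_mul2r; apply/orP; right; lia.
by move=> a; rewrite inE => /andP[].
Qed.

(** Three losses of at most [#|T| / (8 * K)] leave more than half of a degree [#|T| / K]. *)
Lemma cross_degree c a (A B B0 : {set T}) :
  #|T| <= K * #|cnbr c a setT| -> 8 * K * #|cnbr c a A| <= #|T| ->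
  8 * K * #|~: (A :|: B)| <= #|T| -> 8 * K * #|B :\: B0| <= #|T| ->
  #|T| <= 2 * K * #|cnbr c a B0|.
Proof.
move=> degT degA leR leB.
suff : #|cnbr c a setT| <=
    #|cnbr c a A| + (#|~: (A :|: B)| + (#|B :\: B0| + #|cnbr c a B0|)) by nia.
have sub : cnbr c a setT \subset
    cnbr c a A :|: (~: (A :|: B) :|: (B :\: B0 :|: cnbr c a B0)).
  apply/subsetP=> w; rewrite !inE /= => -> /=.
  by case: (w \in A); case: (w \in B); case: (w \in B0).
apply: leq_trans (subset_leq_card sub) _.
do 3![apply: leq_trans (leq_card_setU _ _).1 _; rewrite leq_add2l].
by [].
Qed.

(** * Alternating four-cycles *)

Definition distinguish (B : {set T}) a a' :=
  [set b in B | (f a b == blue) && (f a' b == red)].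

(** For [b] in [distinguish B a a'] and [b'] in [distinguish B a' a], the four-cycle [a b a' b']
    alternates in colour. *)
Definition twisted_pairs (J : nat) (A B : {set T}) :=
  [set p in setX A A | (#|T| <= J * #|distinguish B p.1 p.2|) &&
                       (#|T| <= J * #|distinguish B p.2 p.1|)].

(** Each side is the difference of the two red neighbourhoods in [B], taken in opposite orders;
    their intersection cancels. *)
Lemma distinguish_le (B : {set T}) a a' :
  #|[set b in B | f a' b == red]| <= #|[set b in B | f a b == red]| ->
  #|distinguish B a a'| <= #|distinguish B a' a|.
Proof.
rewrite -(cardsID [set b | f a b == red]) -[leqRHS](cardsID [set b | f a' b == red]).
rewrite (_ : #|_ :&: _| = #|[set b in B | f a b == red] :&: [set b | f a' b == red]|); last first.
  by apply: eq_card => b; rewrite !inE -!andbA; congr (_ && _); rewrite andbC.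
rewrite leq_add2l.
rewrite (_ : #|_ :\: _| = #|distinguish B a a'|); last first.
  by apply: eq_card => b; rewrite !inE; case: (b \in B); case: (f a b); case: (f a' b).
rewrite (_ : #|_ :\: _| = #|distinguish B a' a|) //.
by apply: eq_card => b; rewrite !inE; case: (b \in B); case: (f a b); case: (f a' b).
Qed.

(* A vertex of L, the set of vertices of A of largest red degree to B, is
   separated from many vertices a' of A by many b; comparing red degrees, as
   many b separate the two in the opposite way. *)
Lemma many_twisted_pairs (A B : {set T}) :
  0 < #|A| ->
  (forall a, a \in A -> #|T| <= 2 * K * #|cnbr blue a B|) ->
  (forall b, b \in B -> #|T| <= 2 * K * #|cnbr red b A|) ->
  #|T| ^ 2 <= 128 * K ^ 3 * #|twisted_pairs (16 * K ^ 2) A B|.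
Proof.
move=> A_gt0 degA degB; set J := 16 * K ^ 2; have M_gt0 := ltnW M_gt1.
have cnbr_sub c v (S : {set T}) : #|cnbr c v S| <= #|S|.
  by apply/subset_leq_card/subsetP=> w; rewrite inE => /andP[].
have leA : #|T| <= 2 * K * #|A|.
  have /card_gt0P[a /degA leB] := A_gt0.
  have /card_gt0P[b] : 0 < #|cnbr blue a B|.
    by case: posnP leB => // ->; rewrite muln0 leqNgt T_gt0.
  rewrite inE => /andP[/degB le_b _]; apply: leq_trans le_b _.
  by rewrite leq_mul2l cnbr_sub orbT.
(* Discarding [L] costs a vertex of [B] at most half of its guaranteed red degree to [A], while [L]
   keeps at least [#|T| / (8 * K)] vertices. *)
pose l := #|T| %/ (4 * K).
have le_l : 4 * K * l <= #|T| by rewrite mulnC leq_trunc_div.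
have K_le : 4 * K <= #|T|.
  apply: leq_trans leMn; apply: leq_trans (_ : M ^ 1 <= _); last by rewrite leq_pexp2l.
  rewrite expn1; apply: leq_trans Q_le_M; have := leKQ.
  have : K ^ 1 <= K ^ 4 by rewrite leq_pexp2l.
  by rewrite expn1; lia.
have ge_l : #|T| <= 8 * K * l.
  have := ltn_ceil #|T| (_ : 0 < 4 * K); rewrite -/l; have : 0 < l by rewrite divn_gt0 //; lia.
  by nia.
have [|L [LA cL topL]] := @exists_top T (fun a => #|[set b in B | f a b == red]|) A l.
  by nia.
pose g a := [set a' in A :\: L | #|T| <= J * #|distinguish B a a'|].
have le_g a : a \in L -> #|T| <= J * #|g a|.
  move=> aL; have aA := subsetP LA a aL.
  have sumD : #|T| * #|T| <= 8 * K ^ 2 * \sum_(a' in A :\: L) #|distinguish B a a'|.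
    pose Na := [set b in B | f a b == blue].
    have -> : \sum_(a' in A :\: L) #|distinguish B a a'| =
              \sum_(b in Na) #|[set a' in A :\: L | f a' b == red]|.
      rewrite double_count; apply: eq_bigr => a' _.
      by apply: eq_card => b; rewrite !inE andbA.
    have le_b b : b \in Na -> #|T| <= 4 * K * #|[set a' in A :\: L | f a' b == red]|.
      rewrite inE => /andP[/degB le_b _].
      suff : #|cnbr red b A| <= #|[set a' in A :\: L | f a' b == red]| + #|L|.
        by rewrite cL; nia.
      apply: leq_trans (leq_card_setU _ _).1; apply/subset_leq_card/subsetP=> w.
      rewrite !inE fsym => /and3P[-> _ ->]; rewrite !andbT; exact: orNb.
    have leNa : #|T| <= 2 * K * #|Na|.
      apply: leq_trans (degA a aA) _; rewrite leq_mul2l; apply/orP; right.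
      apply/subset_leq_card/subsetP=> w; rewrite !inE => /and3P[-> _ ->] //.
    have := leq_sum (index_enum _) le_b; rewrite sum_nat_const -big_distrr /=.
    set s := \sum_(b in Na) _ => le_s.
    apply: leq_trans (_ : 2 * K * #|Na| * #|T| <= _).
      by rewrite leq_mul2r leNa orbT.
    have -> : 8 * K ^ 2 * s = 2 * K * (4 * K * s) by rewrite -mulnn; lia.
    by rewrite -mulnA leq_mul2l le_s orbT.
  (* Vertices outside [g a] account for at most [#|T| ^ 2], while [sumD] and [J = 16 * K ^ 2] make
     the left side at least twice that. *)
  have le_split : J * \sum_(a' in A :\: L) #|distinguish B a a'| <=
      J * #|g a| * #|T| + #|T| * #|T|.
    rewrite (big_setID (g a)) /= mulnDr leq_add //.
      rewrite -mulnA leq_mul2l; apply/orP; right.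
      apply: leq_trans (_ : \sum_(a' in (A :\: L) :&: g a) #|T| <= _).
        by apply: leq_sum => a' _; exact: max_card.
      by rewrite sum_nat_const leq_mul2r subset_leq_card ?orbT // subsetIr.
    apply: leq_trans (_ : \sum_(a' in (A :\: L) :\: g a) #|T| <= _).
      rewrite big_distrr leq_sum // => a' /setDP[a'D]; rewrite inE a'D /= -ltnNge.
      exact: ltnW.
    by rewrite sum_nat_const leq_mul2r max_card orbT.
  rewrite -(leq_pmul2r T_gt0); move: le_split sumD; rewrite /J.
  by set s := \sum_(a' in A :\: L) _; lia.
have leG : l * #|T| <= J * #|twisted_pairs J A B|.
  rewrite -cL -sum_nat_const; apply: leq_trans (leq_sum _ le_g) _.
  rewrite -big_distrr leq_mul2l /=; apply/orP; right.
  apply: leq_trans (_ : #|[set p in twisted_pairs J A B | p.1 \in L]| <= _).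
    rewrite (_ : \sum_(a in L) #|g a| = \sum_(a in L) \sum_(a' in g a) 1); last first.
      by apply: eq_bigr => a _; rewrite sum1_card.
    rewrite pair_big_dep /= sum1dep_card.
    apply/subset_leq_card/subsetP=> -[a a']; rewrite !inE /=.
    move=> /and3P[aL /andP[a'L a'A] le_aa'].
    rewrite (subsetP LA) // a'A aL le_aa' /= andbT.
    apply: leq_trans le_aa' _; rewrite leq_mul2l; apply/orP; right.
    by apply: distinguish_le; apply: topL; rewrite // inE a'L.
  by apply/subset_leq_card/subsetP=> p; rewrite inE => /andP[].
rewrite -mulnn; apply: leq_trans (_ : 8 * K * l * #|T| <= _).
  by rewrite leq_mul2r ge_l orbT.
have -> : 128 * K ^ 3 = 8 * K * J by rewrite /J (expnS K 2); lia.
by rewrite -(mulnA (8 * K) l) -(mulnA (8 * K) J) leq_mul2l leG orbT.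
Qed.

(** * Construction of the pattern P_t *)

Lemma induces_P_of_min_degree :
  (forall c v, #|T| <= K * #|cnbr c v setT|) -> exists W, induces_P f t W.
Proof.
move=> degT; have M_gt0 := ltnW M_gt1; have n_gt0 := T_gt0.
have KM : 128 * K ^ 3 <= M.
  apply: leq_trans Q_le_M; apply: leq_trans (_ : 512 * (256 * K ^ 4) <= _).
    by have : K ^ 3 <= K ^ 4; [rewrite leq_pexp2l | lia].
  by rewrite leq_mul2l leKQ orbT.
have KK3 : K <= K ^ 3 by rewrite -[X in X <= _]expn1 leq_pexp2l.
have K2M : 2 * K <= M by lia.
(* This gives [M ^ 6 <= m], enough for sparsity, while the fewer than [2 * M * m] uncovered vertices
   are at most a fraction [2 / M] of all. *)
pose m := #|T| %/ M ^ 2.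
have M2_gt0 : 0 < M ^ 2 by rewrite expn_gt0 M_gt0.
have le_m : M ^ 2 * m <= #|T| by rewrite mulnC leq_trunc_div.
have M6_le_m : M ^ 6 <= m by rewrite leq_divRL // -expnD.
have m_gt0 : 0 < m by apply: leq_trans M6_le_m; rewrite expn_gt0 M_gt0.
have ge_m : #|T| <= 2 * M ^ 2 * m.
  have := ltn_ceil #|T| M2_gt0; rewrite -/m; nia.
have QM_le_m : Q * M ^ 2 <= m.
  apply: leq_trans M6_le_m; rewrite (expnD M 4 2) leq_mul2r.
  apply/orP; right; apply: leq_trans (_ : M ^ 1 <= _); last by rewrite leq_pexp2l.
  by have := Q_le_M; rewrite expn1; lia.
have [PA [PB [famA famB dAB leR]]] := free_partition m_gt0.
have [A0 [A0A leA0 degA0]] := trim_sparse (free_family_sparse famA QM_le_m).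
have [B0 [B0B leB0 degB0]] := trim_sparse (free_family_sparse famB QM_le_m).
set A := cover PA in dAB leR A0A leA0 degA0 *.
set B := cover PB in dAB leR B0B leB0 degB0 *.
have{}leR : 8 * K * #|~: (A :|: B)| <= #|T|.
  apply: leq_trans le_m; apply: leq_trans (_ : 8 * K * (2 * M * m) <= _).
    by rewrite leq_mul2l ltnW ?orbT.
  have -> : 8 * K * (2 * M * m) = 16 * K * (M * m) by lia.
  by rewrite -mulnn -(mulnA M M) leq_mul2r; apply/orP; right; lia.
have crossA a : a \in A0 -> #|T| <= 2 * K * #|cnbr blue a B0|.
  by move=> aA; apply: (@cross_degree _ _ A B) => //; exact: degA0.
have crossB b : b \in B0 -> #|T| <= 2 * K * #|cnbr red b A0|.
  by move=> bB; apply: (@cross_degree _ _ B A); rewrite 1?setUC //; exact: degB0.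
have cnbr_sub c v (S : {set T}) : #|cnbr c v S| <= #|S|.
  by apply/subset_leq_card/subsetP=> w; rewrite inE => /andP[].
(* If [A0] and [B0] were both empty, three remainders of at most [#|T| / (8 * K)] vertices would
   cover everything. *)
have A0_gt0 : 0 < #|A0|.
  have [B0_0|/card_gt0P[b /crossB leb]] := posnP #|B0|; last first.
    case: (posnP #|A0|) => // A0_0; have := cnbr_sub red b A0; rewrite A0_0 leqn0.
    by move=> /eqP cn0; move: leb; rewrite cn0 muln0 leqNgt n_gt0.
  case: (posnP #|A0|) => // A0_0.
  have leT : #|T| <= #|A :\: A0| + (#|B :\: B0| + #|~: (A :|: B)|).
    rewrite (cards0_eq A0_0) (cards0_eq B0_0) !setD0 addnA -(cardsC (A :|: B)).
    by rewrite leq_add2r (leq_card_setU _ _).1.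
  have := leq_mul (leqnn (8 * K)) leT; rewrite !mulnDr; nia.
have leB0T : #|T| <= 2 * K * #|B0|.
  have /card_gt0P[a /crossA lea] := A0_gt0; apply: leq_trans lea _.
  by rewrite leq_mul2l cnbr_sub orbT.
have B0_gt0 : 0 < #|B0| by case: posnP leB0T => // ->; rewrite muln0 leqNgt n_gt0.
have leG := many_twisted_pairs A0_gt0 crossA crossB.
set G := twisted_pairs _ A0 B0 in leG.
pose E (p s : T * T) := [&& f p.1 s.1 == blue, f p.2 s.1 == red,
                            f p.2 s.2 == blue & f p.1 s.2 == red].
have cardG : #|G| <= M ^ 32.
  apply: leq_trans (max_card _) _; rewrite card_prod (expnD M 16 16).
  exact: leq_mul.
(* Two densities [1 / (16 * K ^ 2)] multiply to [1 / (256 * K ^ 4)], whence the bound on [Q]. *)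
have degG p : p \in G ->
    #|setX B0 B0| <= Q * #|[set s in setX B0 B0 | E p s]|.
  rewrite inE => /andP[_ /andP[le1 le2]].
  have -> : [set s in setX B0 B0 | E p s] =
      setX (distinguish B0 p.1 p.2) (distinguish B0 p.2 p.1).
    apply/setP=> -[b b']; rewrite !inE /E /=.
    by case: (b \in B0); case: (b' \in B0); rewrite ?andbF //= -!andbA.
  rewrite cardsX cardsX; apply: leq_trans (_ : #|T| * #|T| <= _).
    by rewrite leq_mul ?max_card.
  apply: leq_trans (leq_mul le1 le2) _; rewrite mulnACA leq_mul2r.
  apply/orP; right; apply: leq_trans leKQ.
  by rewrite mulnACA -expnD.
have [W [WG leW comW]] :=
  dependent_random_choice M_gt1 sample_gt1 leQM cardG degG; clear cardG.
have WA p : p \in W -> p.1 \in A0 /\ p.2 \in A0.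
  by move=> /(subsetP WG); rewrite !inE => /andP[/andP[]].
(* Each vertex is a given coordinate of at most [#|T|] pairs, and [W] has at least
   [#|T| ^ 2 / M ^ 2] pairs. *)
have large (U : {set T}) : #|W| <= #|U| * #|T| -> #|T| <= M ^ 2 * #|U|.
  move=> leU; rewrite -(leq_pmul2r n_gt0) mulnn; apply: leq_trans leG _.
  rewrite -(mulnA (M ^ 2)) -mulnn -(mulnA M M) leq_mul //.
  by rewrite (leq_trans leW) // leq_mul2l leU orbT.
have subA1 : fst @: W \subset A.
  by apply/subsetP=> _ /imsetP[p /WA[pA _] ->]; exact: (subsetP A0A).
have subA2 : snd @: W \subset A.
  by apply/subsetP=> _ /imsetP[p /WA[_ pA] ->]; exact: (subsetP A0A).
have [||V1 [V2 [V1W V2W cV1 cV2 [dV12 iV12]]]] :=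
    free_family_join famA ge_m subA1 subA2.
- by apply: large; rewrite -cardsT; apply: card_le_fst => p; rewrite inE.
- by apply: large; rewrite mulnC -cardsT; apply: card_le_snd => p; rewrite inE.
(* [V1] and [V2] may come from unrelated pairs: [E p s] splits into conditions on [p.1] and on [p.2]
   separately. *)
have [Z1 [Z1W cZ1 Z1P]] := exists_transversal V1W.
have [Z2 [Z2W cZ2 Z2P]] := exists_transversal V2W.
pose Y := [set s in setX B0 B0 | [forall p in Z1 :|: Z2, E p s]].
have leY : #|setX B0 B0| <= M * #|Y|.
  apply: comW; first by rewrite subUset Z1W.
  apply: leq_trans (leq_card_setU _ _).1 _.
  by rewrite mul2n -addnn -{1}cV1 -cV2 leq_add.
have YB s : s \in Y -> s.1 \in B0 /\ s.2 \in B0.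
  by rewrite !inE => /andP[/andP[]].
have YV1 s x : s \in Y -> x \in V1 -> f x s.1 = blue /\ f x s.2 = red.
  rewrite inE => /andP[_ /forall_inP Es] /Z1P[p pZ <-].
  by have /and4P[/eqP -> _ _ /eqP ->] := Es p (subsetP (subsetUl _ _) _ pZ).
have YV2 s x : s \in Y -> x \in V2 -> f x s.1 = red /\ f x s.2 = blue.
  rewrite inE => /andP[_ /forall_inP Es] /Z2P[p pZ <-].
  by have /and4P[_ /eqP -> /eqP -> _] := Es p (subsetP (subsetUr _ _) _ pZ).
have largeY (U : {set T}) : #|Y| <= #|U| * #|B0| -> #|T| <= M ^ 2 * #|U|.
  move=> leU; have leB : #|B0| <= M * #|U|.
    rewrite -(leq_pmul2r B0_gt0) -cardsX (leq_trans leY) // -mulnA.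
    by rewrite leq_mul2l leU orbT.
  by apply: leq_trans leB0T _; rewrite -mulnn -(mulnA M M) leq_mul.
have subB1 : fst @: Y \subset B.
  by apply/subsetP=> _ /imsetP[p /YB[pB _] ->]; exact: (subsetP B0B).
have subB2 : snd @: Y \subset B.
  by apply/subsetP=> _ /imsetP[p /YB[_ pB] ->]; exact: (subsetP B0B).
(* [V3] consists of second coordinates and [V4] of first ones, because [E] makes [p.1] red to [s.2]
   and blue to [s.1]. *)
have [||V3 [V4 [V3Y V4Y cV3 cV4 [dV34 iV34]]]] :=
    free_family_join famB ge_m subB2 subB1.
- by apply: largeY; rewrite mulnC; apply: card_le_snd => p /YB[].
- by apply: largeY; apply: card_le_fst => p /YB[].
have dis (X X' : {set T}) : X \subset A -> X' \subset B -> [disjoint X & X'].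
  by move=> XA X'B; apply: disjointWl XA _; apply: disjointWr X'B _.
have V1A := subset_trans V1W subA1; have V2A := subset_trans V2W subA2.
have V3B := subset_trans V3Y subB2; have V4B := subset_trans V4Y subB1.
exists (V1 :|: V2 :|: V3 :|: V4); split.
  rewrite !cardsU !setIUl (disjoint_setI0 dV12) (disjoint_setI0 dV34).
  rewrite !(disjoint_setI0 (dis _ _ V1A _)) // !(disjoint_setI0 (dis _ _ V2A _)) //.
  by rewrite !setU0 !cards0 !subn0 cV1 cV2 cV3 cV4 !mulSn mul0n addn0 !addnA.
exists V1, V2, V3, V4; split; first by split=> //; split=> //; exact: dis.
split=> //.
- by move=> x y xV1 /(subsetP V3Y)/imsetP[s sY ->] _; case: (YV1 s x sY xV1).
- by move=> x y xV2 /(subsetP V4Y)/imsetP[s sY ->] _; case: (YV2 s x sY xV2).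
- by move=> x y xV1 /(subsetP V4Y)/imsetP[s sY ->] _; case: (YV1 s x sY xV1).
by move=> x y xV2 /(subsetP V3Y)/imsetP[s sY ->] _; case: (YV2 s x sY xV2).
Qed.

End LocallyUnavoidable.

(** * Choice of the integer parameters *)

Lemma locally_unavoidable_nat :
  exists N, forall (T : finType) (f : T -> T -> bool) (t K : nat),
    symmetric f -> 0 < t -> 1 < K -> K ^ (N * t) <= #|T| ->
    (forall c v, #|T| <= K * cdeg f c v) -> has_locally_unavoidable f t.
Proof.
(* The 8 comes from [M0 ^ 8], the 1 from [2 <= K], the 16 from [Q = K ^ 16], and [2 * (32 * 2)] from
   dependent random choice. *)
exists (8 * (1 + 16 * (2 * (32 * 2)))) => T f t K fsym t_gt0 K_gt1 leT degT.
have K_gt0 := ltnW K_gt1.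
have [[W KttW]|noKtt] := classic (exists W, induces_Ktt f t W).
  by exists W; left.
pose Q := K ^ 16; pose M0 := 2 * Q ^ (2 * (32 * (2 * t))).
have leM0 : M0 ^ 8 <= #|T|.
  apply: leq_trans leT; rewrite /M0 /Q -expnM.
  apply: leq_trans (_ : (K ^ ((1 + 16 * (2 * (32 * 2))) * t)) ^ 8 <= _); last first.
    by rewrite -expnM leq_pexp2l //; lia.
  rewrite leq_exp2r //; apply: leq_trans (_ : K * K ^ (16 * (2 * (32 * (2 * t)))) <= _).
    by rewrite leq_mul2r K_gt1 orbT.
  by rewrite -expnS leq_pexp2l //; lia.
(* [M] is taken maximal, not equal to [M0], to get an upper bound too:
   [#|T| < M.+1 ^ 8 <= M ^ 16]. *)
have exM : exists M, M ^ 8 <= #|T| by exists M0.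
have ubM M : M ^ 8 <= #|T| -> M <= #|T|.
  apply: leq_trans; case: M => // M.
  by rewrite -{1}(expn1 M.+1) leq_pexp2l.
case: (ex_maxnP exM ubM) => M leM maxM.
have le_M0M := maxM M0 leM0.
have Q_gt0 : 0 < Q by rewrite expn_gt0 K_gt0.
have M_gt1 : 1 < M.
  by apply: leq_trans le_M0M; rewrite -{1}(muln1 2) leq_mul2l expn_gt0 Q_gt0.
have lenM : #|T| <= M ^ 16.
  apply: leq_trans (_ : M.+1 ^ 8 <= _).
    by rewrite ltnW // ltnNge; apply/negP=> /maxM; rewrite ltnn.
  rewrite -[16]/(2 * 8) expnM leq_exp2r // -mulnn.
  by move: M_gt1; clear; nia.
have leKQ : 256 * K ^ 4 <= Q.
  rewrite /Q -[16]/(8 + 8) expnD leq_mul //; last by rewrite leq_pexp2l.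
  by rewrite -[256]/(2 ^ 8) leq_exp2r.
have degT' c v : #|T| <= K * #|cnbr f c v setT|.
  apply: leq_trans (degT c v) _; rewrite leq_mul2l; apply/orP; right.
  by apply/subset_leq_card/subsetP=> w; rewrite !inE.
have [W PW] := induces_P_of_min_degree fsym t_gt0 K_gt0 leKQ le_M0M leM lenM noKtt degT'.
by exists W; right.
Qed.

(* Passage to real [eps] *)
From mathcomp Require Import all_order all_algebra.
From mathcomp Require Import all_classical all_reals all_analysis.
From mathcomp Require Import lra.
Import Order.TTheory GRing.Theory Num.Theory.
Local Open Scope ring_scope.

Theorem theorem2 (R : realType) :
  exists C : R, 0 < C /\
    forall (eps : R) (t n : nat),
      0 < eps -> eps < 1 / 2 -> (0 < t)%N -> (0 < n)%N ->
      eps `^ (- (C * t%:R)) < n%:R ->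
      forall f : 'I_n -> 'I_n -> bool,
        symmetric f ->
        (forall v : 'I_n, eps * n%:R <= (cdeg f red v)%:R /\
                          eps * n%:R <= (cdeg f blue v)%:R) ->
        has_locally_unavoidable f t.
Proof.
have [N locN] := locally_unavoidable_nat.
(* The factor 2 pays for [K <= x ^ 2]; the successor keeps the constant positive even for
   [N = 0]. *)
exists (2 * N).+1%:R; split=> [|eps t n eps_gt0 eps_lt t_gt0 _ len f fsym degf].
  by rewrite ltr0n.
pose x := eps^-1; have x_gt2 : 2 < x.
  by rewrite /x -[2]invrK ltf_pV2 ?posrE ?invr_gt0 // -[2^-1]mul1r.
have x_ge0 : 0 <= x by rewrite invr_ge0 ltW.
(* Rounding [x] up keeps the degree condition, and [x > 2] gives [K <= x + 1 <= x ^ 2]. *)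
pose K := (Num.truncn x).+1.
have /andP[leKx ltxK] := truncn_itv x_ge0.
have K_gt1 : (1 < K)%N.
  by rewrite -(ltr_nat R) (lt_trans _ ltxK) // (lt_trans _ x_gt2) // ltr1n.
have leK : K%:R <= x ^+ 2.
  rewrite /K -natr1 expr2; nra.
apply: (locN _ f t K) => //.
  rewrite card_ord -(ler_nat R) natrX; apply: le_trans _ (ltW len).
  rewrite -natrM powRN powR_mulrn ?(ltW eps_gt0) // -exprVn -/x.
  apply: (@le_trans _ _ ((x ^+ 2) ^+ (N * t))).
    by rewrite lerXn2r ?nnegrE ?ler0n ?exprn_ge0.
  rewrite -exprM; apply: ler_weXn2l; first by lra.
  by rewrite mulnA leq_mul2r leqnSn orbT.
move=> c v; rewrite card_ord -(ler_nat R) natrM.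
have degc : eps * n%:R <= (cdeg f c v)%:R by case: c (degf v) => -[].
apply: (@le_trans _ _ (x * (cdeg f c v)%:R)); last first.
  by rewrite ler_wpM2r ?ler0n // ltW.
by rewrite /x mulrC ler_pdivlMr // mulrC.
Qed.
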